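(* Let $(X,\mathcal A)$ be a measurable space, $\bar y\in(0,\infty]$, $k\in(0,\bar y]$, $m\in\mathcal M_{(X,\mathcal A)}$, let $\vartriangle\colon m(\mathcal A)\times m(\mathcal A)\to m(\mathcal A)$ be an operation, and let $\star,\lozenge\colon[0,\bar y]^2\to[0,\bar y]$ be non-decreasing fusion functions such that $\lozenge$ is left-continuous. Let $\varphi_i\colon[0,\bar y]\to[0,\bar y]$ ($i=1,2,3$) be functions such that $\varphi_1$ is non-decreasing and $\varphi_2,\varphi_3$ are increasing and right-continuous. Let $\psi_i\colon[0,\varphi_i(\bar y)]\to[0,\bar y]$ ($i=1,2,3$) be non-decreasing, with $\psi_2,\psi_3$ left-continuous. Let $\circ_i\colon[0,\bar y]\times m(\mathcal A)\to[0,\bar y]$ ($i=1,2,3$) be non-decreasing such that $\varphi_i(\bar y)\circ_i m(X)\le\varphi_i(\bar y)$ for $i=1,2,3$ and $\bar y\circ_j 0=0$ for $j=2,3$. (a) Assume that $$\psi_1\big(\varphi_1(a\star b)\circ_1(c\vartriangle d)\big)\ge\psi_2\big(\varphi_2(a)\circ_2 c\big)\lozenge\psi_3\big(\varphi_3(b)\circ_3 d\big)\qquad(\ast)$$ holds for all $a,b\in[0,k]$ and $c,d\in m(\mathcal A)$. If $f,g\in\mathcal F^{k}_{(X,\mathcal A)}$ and $A,B\in\mathcal A$ are such that $f|_A$ and $g|_B$ are $m$-positively dependent with respect to $\vartriangle$, then $$\psi_1\big(\mathbf I_{\circ_1,A\cap B}(m,\varphi_1(f\star g))\big)\ge\psi_2\big(\mathbf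 I_{\circ_2,A}(m,\varphi_2(f))\big)\lozenge\psi_3\big(\mathbf I_{\circ_3,B}(m,\varphi_3(g))\big).\qquad(\ast\ast)$$ (b) Suppose that $\bar y\circ_1 0=0$, that $a\vartriangle 0=0\vartriangle a=0$ for all $a\in m(\mathcal A)$, and that for all $c,d\in m(\mathcal A)$ there exist sets $C,D\in\mathcal A$ such that $c=m(C)$, $d=m(D)$ and $m(C\cap D)=m(C)\vartriangle m(D)$. If $(\ast\ast)$ is true for all $A,B\in\mathcal A$ and all $f,g\in\mathcal F^{k}_{(X,\mathcal A)}$ such that $f|_A,g|_B$ are $m$-positively dependent with respect to $\vartriangle$, then $(\ast)$ holds for all $a,b\in[0,k]$ and $c,d\in m(\mathcal A)$.
   Context: $(X,\mathcal A)$ is a measurable space ($X$ non-empty, $\mathcal A$ a $\sigma$-algebra). $\mathcal F^{k}_{(X,\mathcal A)}$ is the set of all $\mathcal A$-measurable functions $f\colon X\to[0,k]$. $\mathcal M_{(X,\mathcal A)}$ is the set of monotone measures: set functions $m\colon\mathcal A\to[0,\infty]$ with $m(A)\le m(B)$ whenever $A\subset B$, $m(\emptyset)=0$, $m(X)>0$. $m(\mathcal A)=\{m(A):A\in\mathcal A\}$ is the range of $m$. A fusion function is a binary operation $[0,\bar y]^2\to[0,\bar y]$. A function $\circ\colon Y_1\times Y_2\to[0,\infty]$ is non-decreasing if $a_1\circ a_2\le b_1\circ b_2$ whenever $a_i\le b_i$, $a_i,b_i\in Y_i$. A non-decreasing fusion function is left-continuous if it is left-continuous in each coordinate. ''Increasing''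 (for functions of one variable) means strictly increasing. $f\star g$ is the pointwise operation $x\mapsto f(x)\star g(x)$, and $\varphi(f)=\varphi\circ f$ is the composition. Generalized (upper) Sugeno integral: for $D\in\mathcal A$, a measurable $f\colon X\to[0,\bar y]$ and a non-decreasing $\circ$, $$\mathbf I_{\circ,D}(m,f)=\sup_{t\in[0,\bar y]}\{t\circ m(D\cap\{f\ge t\})\},\qquad \{f\ge t\}=\{x\in X: f(x)\ge t\}.$$ For $f,g\in\mathcal F^k_{(X,\mathcal A)}$ and $A,B\in\mathcal A$, the functions $f|_A$ and $g|_B$ are $m$-positively dependent with respect to $\vartriangle\colon m(\mathcal A)\times m(\mathcal A)\to m(\mathcal A)$ if for all $\alpha,\beta\in[0,k]$ $$m(A\cap B\cap\{f\ge\alpha\}\cap\{g\ge\beta\})\ge m(A\cap\{f\ge\alpha\})\vartriangle m(B\cap\{g\ge\beta\}).$$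
   Formalization: Inequality (∗∗) is considered only for f, g with φ₁(f⋆g) measurable, so that its integral is defined; in (a) the integral I_{∘₁,A∩B}(m,φ₁(f⋆g)) is also assumed to lie in [0,φ₁(ȳ)], the domain of ψ₁. *)

(* Defs.v *)
From HB Require Import structures.
From mathcomp Require Import all_boot all_order all_algebra.
From mathcomp Require Import all_classical all_reals all_analysis.
From mathcomp Require Import measurable_realfun.

Set Implicit Arguments.
Unset Strict Implicit.
Unset Printing Implicit Defensive.

Import Order.TTheory GRing.Theory Num.Theory.

Local Open Scope classical_set_scope.
Local Open Scope ereal_scope.

(* Functions and operations defined on a subset of [0, +oo] are represented by
   total functions on \bar R; every property is required on the domain only, so
   that values outside the domain are unspecified. *)

Section Operations.
Context {R : realType}.
Implicit Types (Y Z : set (\bar R)) (y : \bar R).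

Definition eitv0 y : set (\bar R) := `[0, y]%classic.

Definition nondecreasing_on Y (h : \bar R -> \bar R) :=
  forall a b, Y a -> Y b -> a <= b -> h a <= h b.

Definition increasing_on Y (h : \bar R -> \bar R) :=
  forall a b, Y a -> Y b -> a < b -> h a < h b.

(* One-sided limits inside the domain Y, for the usual topology of \bar R; the
   condition is void at a point of Y that no point of Y approaches from the
   relevant side. *)
Definition left_continuous_on Y (h : \bar R -> \bar R) :=
  forall t, Y t -> h s @[s --> within [set s | Y s /\ s < t] (nbhs t)] --> h t.

Definition right_continuous_on Y (h : \bar R -> \bar R) :=
  forall t, Y t -> h s @[s --> within [set s | Y s /\ t < s] (nbhs t)] --> h t.

Definition op_maps Y1 Y2 Z (op : \bar R -> \bar R -> \bar R) :=
  forall a b, Y1 a -> Y2 b -> Z (op a b).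

Definition op_nondecreasing Y1 Y2 (op : \bar R -> \bar R -> \bar R) :=
  forall a1 a2 b1 b2, Y1 a1 -> Y2 a2 -> Y1 b1 -> Y2 b2 ->
    a1 <= b1 -> a2 <= b2 -> op a1 a2 <= op b1 b2.

Definition op_left_continuous Y1 Y2 (op : \bar R -> \bar R -> \bar R) :=
  (forall a2, Y2 a2 -> left_continuous_on Y1 (op^~ a2)) /\
  (forall a1, Y1 a1 -> left_continuous_on Y2 (op a1)).

Definition fusion_function y (op : \bar R -> \bar R -> \bar R) :=
  op_maps (eitv0 y) (eitv0 y) (eitv0 y) op.

End Operations.

Section MonotoneMeasure.
Context {d : measure_display} {X : measurableType d} {R : realType}.
Implicit Types (m : set X -> \bar R) (f g : X -> \bar R) (A B D : set X).

Definition monotone_measure m :=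
  [/\ forall A, measurable A -> 0 <= m A,
      forall A B, measurable A -> measurable B -> A `<=` B -> m A <= m B,
      m set0 = 0 &
      0 < m setT].

Definition mrange m : set (\bar R) := m @` measurable.

(* The class F^k of measurable functions X -> [0, k]. *)
Definition bounded_mfun (k : \bar R) f :=
  measurable_fun setT f /\ forall x, eitv0 k (f x).

(* The generalized (upper) Sugeno integral I_{op,D}(m, f), for functions f with
   values in [0, y]. *)
Definition sugeno_integral (y : \bar R) (op : \bar R -> \bar R -> \bar R) D m f
    : \bar R :=
  ereal_sup [set op t (m (D `&` [set x | t <= f x])) | t in eitv0 y].

Definition positively_dependent (k : \bar R) m
    (tri : \bar R -> \bar R -> \bar R) f A g B :=
  forall alpha beta, eitv0 k alpha -> eitv0 k beta ->
    tri (m (A `&` [set x | alpha <= f x])) (m (B `&` [set x | beta <= g x]))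
    <= m (A `&` B `&` [set x | alpha <= f x] `&` [set x | beta <= g x]).

End MonotoneMeasure.

(* Main.v *)
(* For (a), the integral of phi_i(f) over A is the supremum over a in [0, k] of
   phi_i(a) o_i m(A /\ {f >= a}), and left continuity of psi_2, psi_3 and of the
   outer operation reduces the inequality to one between individual terms of the
   two suprema.  For each pair of levels (a, b) this is the pointwise hypothesis,
   since positive dependence bounds the combined measure by
   m(A /\ B /\ {f >= a} /\ {g >= b}) and f * g >= a * b on that set.

   For (b), the constant functions a on C and b on D are positively dependent,
   and the three integrals reduce to a single term each. *)
Require Import Defs.
From HB Require Import structures.
From mathcomp Require Import all_boot all_order all_algebra.
From mathcomp Require Import all_classical all_reals all_analysis.
From mathcomp Require Import measurable_realfun.

Set Implicit Arguments.
Unset Strict Implicit.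
Unset Printing Implicit Defensive.

Import Order.TTheory GRing.Theory Num.Theory.

Local Open Scope classical_set_scope.
Local Open Scope ereal_scope.

(** * One-sided continuity along suprema and infima in the extended reals *)

Section OneSidedLimits.
Context {R : realType}.
Implicit Types (Y S P : set (\bar R)) (h q : \bar R -> \bar R).

Lemma eitv0E (y t : \bar R) : eitv0 y t <-> 0 <= t /\ t <= y.
Proof. by rewrite /eitv0 /= in_itv /=; split=> /andP. Qed.

Lemma eitv0_ge0 (y t : \bar R) : eitv0 y t -> 0 <= t.
Proof. by move=> /eitv0E[]. Qed.

Lemma eitv0_le (y t : \bar R) : eitv0 y t -> t <= y.
Proof. by move=> /eitv0E[]. Qed.

Lemma eitv0_0 (y : \bar R) : 0 <= y -> eitv0 y 0.
Proof. by move=> y0; apply/eitv0E. Qed.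

Lemma eitv0_top (y : \bar R) : 0 <= y -> eitv0 y y.
Proof. by move=> y0; apply/eitv0E. Qed.

Lemma eitv0_sub (k y : \bar R) : k <= y -> eitv0 k `<=` eitv0 y.
Proof.
by move=> ky t /eitv0E[t0 tk]; apply/eitv0E; split=> //; exact: le_trans ky.
Qed.

Lemma eitv0_ereal_sup (y : \bar R) S :
  S `<=` eitv0 y -> S !=set0 -> eitv0 y (ereal_sup S).
Proof.
move=> Sy [s Ss]; apply/eitv0E; split.
  by apply: le_ereal_sup_tmp; exists s => //; exact: eitv0_ge0 (Sy _ Ss).
by apply: ge_ereal_sup => u /Sy /eitv0_le.
Qed.

(** Some sequence of points of [S] converges to the supremum, so it eventually enters any
    neighbourhood of it. *)
Lemma nbhs_ereal_sup P S :
  S !=set0 -> nbhs (ereal_sup S) P -> exists2 s, S s & P s.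
Proof.
move=> /set0P /ereal_sup_seq[u Su ucvg] /ucvg[n _ Pu].
by exists (u n) => //; exact: Pu n (leqnn n).
Qed.

Lemma nbhs_ereal_inf P S :
  S !=set0 -> nbhs (ereal_inf S) P -> exists2 s, S s & P s.
Proof.
move=> /set0P /ereal_inf_seq[u Su ucvg] /ucvg[n _ Pu].
by exists (u n) => //; exact: Pu n (leqnn n).
Qed.

(** If [M < h (ereal_sup S)], left continuity keeps [h] above [M] at the points of [Y] just below
    the supremum, and [S] has a point that near. Either this point lies strictly below, or it is the
    supremum itself, which the one-sided limit leaves out; both contradict the bound on [S]. *)
Lemma left_continuous_sup_le Y h S (M : \bar R) :
  left_continuous_on Y h -> S `<=` Y -> S !=set0 -> Y (ereal_sup S) ->
  (forall s, S s -> h s <= M) -> h (ereal_sup S) <= M.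
Proof.
move=> hlc SY S0 Ysup hM; rewrite leNgt; apply/negP => Mh.
have /nbhs_ereal_sup[//|s Ss Mhs] := hlc _ Ysup _ (open_ereal_gt_ereal Mh).
have [st|ts] := ltP s (ereal_sup S).
  by have := Mhs (conj (SY _ Ss) st); rewrite /= ltNge hM.
have st : s = ereal_sup S by apply/le_anti; rewrite ereal_sup_ubound.
by move: Mh; rewrite -st ltNge hM.
Qed.

(** Mirror image of the previous argument; it serves to show that the infimum of the levels [a] with
    [t <= phi a] is again such a level. *)
Lemma right_continuous_inf_ge Y h S (t : \bar R) :
  right_continuous_on Y h -> S `<=` Y -> S !=set0 -> Y (ereal_inf S) ->
  (forall s, S s -> t <= h s) -> t <= h (ereal_inf S).
Proof.
move=> hrc SY S0 Yinf th; rewrite leNgt; apply/negP => ht.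
have /nbhs_ereal_inf[//|s Ss ths] := hrc _ Yinf _ (open_ereal_lt_ereal ht).
have [st|ts] := ltP (ereal_inf S) s.
  by have := ths (conj (SY _ Ss) st); rewrite /= ltNge th.
have st : s = ereal_inf S by apply/le_anti; rewrite ts ereal_inf_lbound.
by move: ht; rewrite -st ltNge th.
Qed.

Lemma left_continuous_comp_sup_le (y z : \bar R) h q S (M : \bar R) :
  (forall t, eitv0 z t -> eitv0 y (h t)) ->
  left_continuous_on (eitv0 z) h ->
  nondecreasing_on (eitv0 y) q -> left_continuous_on (eitv0 y) q ->
  S `<=` eitv0 z -> S !=set0 ->
  (forall s, S s -> q (h s) <= M) -> q (h (ereal_sup S)) <= M.
Proof.
move=> hy hlc qnd qlc Sz S0 qM.
have zsup : eitv0 z (ereal_sup S) by exact: eitv0_ereal_sup.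
have hSy : h @` S `<=` eitv0 y by move=> _ [s Ss <-]; exact/hy/Sz.
have hS0 : h @` S !=set0 by case: S0 => s Ss; exists (h s), s.
have ysup : eitv0 y (ereal_sup (h @` S)) by exact: eitv0_ereal_sup.
apply: (@le_trans _ _ (q (ereal_sup (h @` S)))).
  apply: qnd => //; first exact: hy.
  apply: (left_continuous_sup_le hlc) => // s Ss.
  by apply: ereal_sup_ubound; exists s.
by apply: (left_continuous_sup_le qlc) => // _ [s Ss <-]; exact: qM.
Qed.

(** In a total order a strictly increasing map also reflects the order; hence [phi \o f] exceeds
    [phi a] exactly where [f] exceeds [a]. *)
Lemma increasing_on_le Y h a b : increasing_on Y h -> Y a -> Y b ->
  (h a <= h b) = (a <= b).
Proof.
move=> hinc Ya Yb; have [ab|ba|->] := ltgtP a b; last by rewrite lexx.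
- by rewrite ltW// hinc.
- by apply/negbTE; rewrite -ltNge hinc.
Qed.

Lemma increasing_nondecreasing_on Y h :
  increasing_on Y h -> nondecreasing_on Y h.
Proof. by move=> hinc a b Ya Yb ab; rewrite (increasing_on_le hinc). Qed.

End OneSidedLimits.

(** * Superlevel sets and the Sugeno integral of constant and composed functions *)

Section SugenoIntegral.
Context {d : measure_display} {X : measurableType d} {R : realType}.
Variable m : set X -> \bar R.
Hypothesis hm : monotone_measure m.
Implicit Types (f : X -> \bar R) (A B : set X) (op : \bar R -> \bar R -> \bar R).

Lemma mrange_measure A : measurable A -> mrange m (m A).
Proof. by move=> mA; exists A. Qed.

Lemma mrange0 : mrange m 0.
Proof. by have [_ _ <- _] := hm; exact/mrange_measure. Qed.

Lemma mrange_le_setT c : mrange m c -> c <= m setT.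
Proof. by move=> [A mA <-]; have [_ mle _ _] := hm; exact: mle. Qed.

Lemma measurable_superlevel A f (t : \bar R) :
  measurable A -> measurable_fun setT f ->
  measurable (A `&` [set x | t <= f x]).
Proof.
move=> mA mf; apply: measurable_realfun.emeasurable_fun_c_infty => //.
exact: measurable_funS mf.
Qed.

Lemma superlevel_cst A (t z : \bar R) :
  A `&` [set x | t <= cst z x] = if t <= z then A else set0.
Proof. by case: ifPn => tz; apply/seteqP; split=> x // -[]. Qed.

Lemma superlevel_set0 A f (t : \bar R) :
  (forall x, f x < t) -> A `&` [set x | t <= f x] = set0.
Proof.
move=> ft; apply/seteqP; split=> [x [_ tf]|//].
by have := ft x; rewrite ltNge tf.
Qed.

Section Fusion.
Variables (y : \bar R) (op : \bar R -> \bar R -> \bar R).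
Hypothesis op_maps_y : op_maps (eitv0 y) (mrange m) (eitv0 y) op.
Hypothesis op_nd : op_nondecreasing (eitv0 y) (mrange m) op.

(** The superlevel sets are [A] up to level [z], where the term at [z] dominates, and empty above
    it, where the term is at most [op y 0 = 0]. *)
Lemma sugeno_integral_cst A z : op y 0 = 0 ->
  eitv0 y z -> measurable A ->
  sugeno_integral y op A m (cst z) = op z (m A).
Proof.
move=> op0 yz mA; have rA := mrange_measure mA.
have yy : eitv0 y y by apply/eitv0_top/(le_trans (eitv0_ge0 yz))/eitv0_le.
apply/le_anti/andP; split; last first.
  by apply: ereal_sup_ubound; exists z => //; rewrite superlevel_cst lexx.
apply: ge_ereal_sup => _ [t yt <-]; rewrite superlevel_cst.
have [tz|_] := leP t z; first exact: op_nd.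
have [_ _ -> _] := hm; apply: (@le_trans _ _ 0).
  rewrite -[leRHS]op0; apply: op_nd => //; [exact: mrange0|exact: mrange0|].
  exact: eitv0_le.
exact/eitv0_ge0/op_maps_y.
Qed.

(* Right continuity makes the least [a] with [t <= phi a] exist, and
   [phi \o f] reaches [t] exactly where [f] reaches that [a]: only the levels
   [phi a] contribute to the supremum. *)
Lemma sugeno_integral_comp k phi A f : op y 0 = 0 ->
  0 <= k -> k <= y ->
  (forall t, eitv0 y t -> eitv0 y (phi t)) ->
  increasing_on (eitv0 y) phi -> right_continuous_on (eitv0 y) phi ->
  bounded_mfun k f -> measurable A ->
  sugeno_integral y op A m (phi \o f) =
  ereal_sup [set op (phi a) (m (A `&` [set x | a <= f x])) | a in eitv0 k].
Proof.
move=> op0 k0 ky phiy phi_inc phi_rc [mf fk] mA.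
have sub := eitv0_sub ky.
have level a : eitv0 k a ->
    [set x | phi a <= (phi \o f) x] = [set x | a <= f x].
  move=> ka; apply/seteqP; split=> x /=; rewrite (increasing_on_le phi_inc)//;
    exact: sub.
have rA a : mrange m (m (A `&` [set x | a <= f x])).
  exact/mrange_measure/measurable_superlevel.
apply/le_anti/andP; split; last first.
  apply: ge_ereal_sup => _ [a ka <-]; apply: ereal_sup_ubound.
  by exists (phi a); [exact/phiy/sub|rewrite level].
apply: ge_ereal_sup => _ [t yt <-].
have [tk|kt] := leP t (phi k).
  pose E := [set a | eitv0 k a /\ t <= phi a].
  have Ek : E k by split=> //; exact: eitv0_top.
  have ka : eitv0 k (ereal_inf E).
    apply/eitv0E; split; last by apply: ge_ereal_inf; exists k.
    by apply: le_ereal_inf_tmp => a [/eitv0_ge0].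
  have ta : t <= phi (ereal_inf E).
    apply: (right_continuous_inf_ge phi_rc); last by move=> a [].
    - by move=> a [/sub].
    - by exists k.
    - exact: sub.
  apply: le_ereal_sup_tmp.
  exists (op (phi (ereal_inf E)) (m (A `&` [set x | ereal_inf E <= f x]))).
    by exists (ereal_inf E).
  have tE : [set x | t <= (phi \o f) x] = [set x | ereal_inf E <= f x].
    apply/seteqP; split=> x /=.
      by move=> tx; apply: ereal_inf_lbound; split.
    rewrite -(increasing_on_le phi_inc (sub _ ka) (sub _ (fk x))).
    exact: le_trans ta.
  by rewrite tE; apply: op_nd => //; exact/phiy/sub.
(* Levels above [phi k] are never reached by [phi \o f], so their terms are at most [op y 0 = 0] and
   any nonnegative term, here the one at [k], dominates them. *)
rewrite superlevel_set0; last first.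
  move=> x; apply: le_lt_trans kt.
  rewrite (increasing_on_le phi_inc) ?(eitv0_le (fk x))//; apply: sub => //.
  exact: eitv0_top.
have [_ _ -> _] := hm; apply: (@le_trans _ _ 0).
  rewrite -[leRHS]op0; apply: op_nd => //; [exact: mrange0| |exact: mrange0|].
    exact/eitv0_top/(le_trans k0).
  exact: eitv0_le.
apply: le_ereal_sup_tmp; exists (op (phi k) (m (A `&` [set x | k <= f x]))).
  by exists k => //; exact: eitv0_top.
by apply/eitv0_ge0/op_maps_y => //; exact/phiy/sub/eitv0_top.
Qed.

(** Places the terms of the suprema in the domain of [psi]: each is bounded by the term at the
    largest arguments, [y] and [m setT]. *)
Lemma op_phi_eitv0 phi a c : (forall t, eitv0 y t -> eitv0 y (phi t)) ->
  nondecreasing_on (eitv0 y) phi -> op (phi y) (m setT) <= phi y ->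
  eitv0 y a -> mrange m c -> eitv0 (phi y) (op (phi a) c).
Proof.
move=> phiy phi_nd top ya rc.
have yy : eitv0 y y by apply/eitv0_top/(le_trans (eitv0_ge0 ya))/eitv0_le.
apply/eitv0E; split; first by apply/eitv0_ge0/op_maps_y => //; exact: phiy.
apply: le_trans top; apply: op_nd => //; [exact: phiy|exact: phiy| | |].
- exact: mrange_measure.
- by apply: phi_nd => //; exact: eitv0_le.
- exact: mrange_le_setT.
Qed.

End Fusion.
End SugenoIntegral.

Theorem theorem3p1 (R : realType) (d : measure_display) (X : measurableType d)
    (ybar k : \bar R) (m : set X -> \bar R)
    (tri star loz : \bar R -> \bar R -> \bar R)
    (phi1 phi2 phi3 psi1 psi2 psi3 : \bar R -> \bar R)
    (op1 op2 op3 : \bar R -> \bar R -> \bar R)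
    (hybar : 0 < ybar) (hk0 : 0 < k) (hk : k <= ybar)
    (hm : monotone_measure m)
    (htri : op_maps (mrange m) (mrange m) (mrange m) tri)
    (hstar : fusion_function ybar star)
    (hstar_nd : op_nondecreasing (eitv0 ybar) (eitv0 ybar) star)
    (hloz : fusion_function ybar loz)
    (hloz_nd : op_nondecreasing (eitv0 ybar) (eitv0 ybar) loz)
    (hloz_lc : op_left_continuous (eitv0 ybar) (eitv0 ybar) loz)
    (hphi1 : forall t, eitv0 ybar t -> eitv0 ybar (phi1 t))
    (hphi2 : forall t, eitv0 ybar t -> eitv0 ybar (phi2 t))
    (hphi3 : forall t, eitv0 ybar t -> eitv0 ybar (phi3 t))
    (hphi1_nd : nondecreasing_on (eitv0 ybar) phi1)
    (hphi2_inc : increasing_on (eitv0 ybar) phi2)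
    (hphi3_inc : increasing_on (eitv0 ybar) phi3)
    (hphi2_rc : right_continuous_on (eitv0 ybar) phi2)
    (hphi3_rc : right_continuous_on (eitv0 ybar) phi3)
    (hpsi1 : forall t, eitv0 (phi1 ybar) t -> eitv0 ybar (psi1 t))
    (hpsi2 : forall t, eitv0 (phi2 ybar) t -> eitv0 ybar (psi2 t))
    (hpsi3 : forall t, eitv0 (phi3 ybar) t -> eitv0 ybar (psi3 t))
    (hpsi1_nd : nondecreasing_on (eitv0 (phi1 ybar)) psi1)
    (hpsi2_nd : nondecreasing_on (eitv0 (phi2 ybar)) psi2)
    (hpsi3_nd : nondecreasing_on (eitv0 (phi3 ybar)) psi3)
    (hpsi2_lc : left_continuous_on (eitv0 (phi2 ybar)) psi2)
    (hpsi3_lc : left_continuous_on (eitv0 (phi3 ybar)) psi3)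
    (hop1 : op_maps (eitv0 ybar) (mrange m) (eitv0 ybar) op1)
    (hop2 : op_maps (eitv0 ybar) (mrange m) (eitv0 ybar) op2)
    (hop3 : op_maps (eitv0 ybar) (mrange m) (eitv0 ybar) op3)
    (hop1_nd : op_nondecreasing (eitv0 ybar) (mrange m) op1)
    (hop2_nd : op_nondecreasing (eitv0 ybar) (mrange m) op2)
    (hop3_nd : op_nondecreasing (eitv0 ybar) (mrange m) op3)
    (hop1_top : op1 (phi1 ybar) (m setT) <= phi1 ybar)
    (hop2_top : op2 (phi2 ybar) (m setT) <= phi2 ybar)
    (hop3_top : op3 (phi3 ybar) (m setT) <= phi3 ybar)
    (hop2_0 : op2 ybar 0 = 0)
    (hop3_0 : op3 ybar 0 = 0) :
  ((forall a b c e, eitv0 k a -> eitv0 k b -> mrange m c -> mrange m e ->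
      loz (psi2 (op2 (phi2 a) c)) (psi3 (op3 (phi3 b) e))
      <= psi1 (op1 (phi1 (star a b)) (tri c e))) ->
   forall (f g : X -> \bar R) (A B : set X),
     bounded_mfun k f -> bounded_mfun k g -> measurable A -> measurable B ->
     positively_dependent k m tri f A g B ->
     (* phi1(f * g) has an integral, and this integral lies in the domain of
        psi1; neither is a consequence of the other assumptions *)
     measurable_fun setT (fun x => phi1 (star (f x) (g x))) ->
     eitv0 (phi1 ybar)
       (sugeno_integral ybar op1 (A `&` B) m
          (fun x => phi1 (star (f x) (g x)))) ->
     loz (psi2 (sugeno_integral ybar op2 A m (phi2 \o f)))
         (psi3 (sugeno_integral ybar op3 B m (phi3 \o g)))
     <= psi1 (sugeno_integral ybar op1 (A `&` B) m
                (fun x => phi1 (star (f x) (g x)))))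
  /\
  (op1 ybar 0 = 0 ->
   (forall a, mrange m a -> tri a 0 = 0 /\ tri 0 a = 0) ->
   (forall c e, mrange m c -> mrange m e ->
      exists C D : set X,
        [/\ measurable C, measurable D, c = m C, e = m D &
            m (C `&` D) = tri (m C) (m D)]) ->
   (forall (A B : set X) (f g : X -> \bar R),
      measurable A -> measurable B -> bounded_mfun k f -> bounded_mfun k g ->
      positively_dependent k m tri f A g B ->
      (* phi1(f * g) has an integral; it then lies in the domain of psi1, since
         op1 ybar 0 = 0 *)
      measurable_fun setT (fun x => phi1 (star (f x) (g x))) ->
      loz (psi2 (sugeno_integral ybar op2 A m (phi2 \o f)))
          (psi3 (sugeno_integral ybar op3 B m (phi3 \o g)))
      <= psi1 (sugeno_integral ybar op1 (A `&` B) m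
                 (fun x => phi1 (star (f x) (g x))))) ->
   forall a b c e, eitv0 k a -> eitv0 k b -> mrange m c -> mrange m e ->
     loz (psi2 (op2 (phi2 a) c)) (psi3 (op3 (phi3 b) e))
     <= psi1 (op1 (phi1 (star a b)) (tri c e))).
Proof.
have k_ge0 : 0 <= k by exact: ltW.
have sub := eitv0_sub hk.
have phi2_nd := increasing_nondecreasing_on hphi2_inc.
have phi3_nd := increasing_nondecreasing_on hphi3_inc.
have mle : forall A B, measurable A -> measurable B -> A `<=` B -> m A <= m B.
  by have [] := hm.
split.

  (* From the pointwise inequality to the integral inequality *)
  move=> H f g A B bf bg mA mB pd mfg Idom.
  have [mf fk] := bf; have [mg gk] := bg.
  have rA a : mrange m (m (A `&` [set x | a <= f x])).
    exact/mrange_measure/measurable_superlevel.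
  have rB b : mrange m (m (B `&` [set x | b <= g x])).
    exact/mrange_measure/measurable_superlevel.
  rewrite (sugeno_integral_comp hm hop2 hop2_nd hop2_0 k_ge0)//.
  rewrite (sugeno_integral_comp hm hop3 hop3_nd hop3_0 k_ge0)//.
  set S2 := [set _ | _ in _]; set S3 := [set _ | _ in _].
  set I1 := sugeno_integral _ _ _ _ _ in Idom *.
  have S2sub : S2 `<=` eitv0 (phi2 ybar).
    move=> _ [a ka <-].
    by apply: (op_phi_eitv0 hm hop2 hop2_nd) => //; exact: sub.
  have S3sub : S3 `<=` eitv0 (phi3 ybar).
    move=> _ [b kb <-].
    by apply: (op_phi_eitv0 hm hop3 hop3_nd) => //; exact: sub.
  have S20 : S2 !=set0.
    by exists (op2 (phi2 0) (m (A `&` [set x | 0 <= f x]))), 0; first exact: eitv0_0.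
  have S30 : S3 !=set0.
    by exists (op3 (phi3 0) (m (B `&` [set x | 0 <= g x]))), 0; first exact: eitv0_0.
  have loz_le s u : S2 s -> S3 u -> loz (psi2 s) (psi3 u) <= psi1 I1.
    move=> [a ka <-] [b kb <-]; apply: le_trans (H _ _ _ _ ka kb (rA a) (rB b)) _.
    have yab : eitv0 ybar (star a b) by apply: hstar; exact: sub.
    set c := tri _ _; have rc : mrange m c by exact: htri.
    apply: hpsi1_nd => //; first exact: (op_phi_eitv0 hm hop1 hop1_nd).
    (* The supremum [I1] is tested at the level [phi1 (star a b)]. Monotonicity of [star] and [phi1]
       puts every point of [A] and [B] with [a <= f x] and [b <= g x] in this superlevel set, and
       positive dependence bounds the measure of those points below by [c]. *)
    apply: le_ereal_sup_tmp; exists (op1 (phi1 (star a b)) (m (A `&` B `&`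
        [set x | phi1 (star a b) <= phi1 (star (f x) (g x))]))).
      by exists (phi1 (star a b)) => //; exact: hphi1.
    have mAB := measurableI _ _ mA mB.
    apply: hop1_nd => //; [exact: hphi1|exact: hphi1| | ].
      exact/mrange_measure/measurable_superlevel.
    apply: le_trans (pd _ _ ka kb) _; apply: mle.
    - by do 2 apply: measurable_superlevel => //.
    - exact: measurable_superlevel.
    - move=> x [[ABx /= afx] bgx]; split=> //=.
      apply: hphi1_nd => //; first by apply: hstar; exact: sub.
      by apply: hstar_nd => //; exact: sub.
  have [loz_lc2 loz_lc3] := hloz_lc.
  have dom3 : eitv0 ybar (psi3 (ereal_sup S3)).
    by apply: hpsi3; exact: eitv0_ereal_sup.
  (* The suprema are removed one at a time: first [ereal_sup S2], with the right argument of [loz]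
     frozen at [psi3 (ereal_sup S3)], then [ereal_sup S3], with the left one frozen at [psi2 s]. *)
  apply: (left_continuous_comp_sup_le (q := loz^~ _) hpsi2 hpsi2_lc) => //.
  - by move=> a b ya yb ab; exact: hloz_nd.
  - exact: loz_lc2.
  move=> s S2s; have dom2 : eitv0 ybar (psi2 s) by exact/hpsi2/S2sub.
  apply: (left_continuous_comp_sup_le (q := loz _) hpsi3 hpsi3_lc) => //.
  - by move=> a b ya yb ab; exact: hloz_nd.
  - exact: loz_lc3.
  - by move=> u S3u; exact: loz_le.

(* From the integral inequality back to the pointwise one *)
move=> op1_0 tri0 ex H a b c e ka kb rc re.
have [C [D [mC mD cE eE CDE]]] := ex c e rc re.
have yab : eitv0 ybar (star a b) by apply: hstar; exact: sub.
have [_ _ m0 _] := hm.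
(* For [al <= a] and [be <= b] this is the choice of [C] and [D]; otherwise some superlevel set is
   empty and both sides vanish, 0 being an annihilator of [tri]. *)
have pd : positively_dependent k m tri (cst a) C (cst b) D.
  move=> al be kal kbe; rewrite !superlevel_cst.
  have [_|_] := leP al a; have [_|_] := leP be b; rewrite ?m0.
  - by rewrite CDE.
  - by rewrite (tri0 _ (mrange_measure m mC)).1.
  - by rewrite (tri0 _ (mrange_measure m mD)).2.
  - by rewrite (tri0 _ (mrange0 hm)).2.
have I1E : sugeno_integral ybar op1 (C `&` D) m (cst (phi1 (star a b))) =
    op1 (phi1 (star a b)) (m (C `&` D)).
  by apply: (sugeno_integral_cst hm hop1) => //;
    [exact: hphi1|exact: measurableI].
have I2E : sugeno_integral ybar op2 C m (cst (phi2 a)) = op2 (phi2 a) (m C).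
  by apply: (sugeno_integral_cst hm hop2) => //; exact/hphi2/sub.
have I3E : sugeno_integral ybar op3 D m (cst (phi3 b)) = op3 (phi3 b) (m D).
  by apply: (sugeno_integral_cst hm hop3) => //; exact/hphi3/sub.
(* The constant integrands agree by conversion with the composites that [H] yields for [cst a] and
   [cst b]. *)
rewrite cE eE -CDE -I1E -I2E -I3E; apply: H => //; split => //.
Qed.
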